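(* Let $\vartheta>0$ and $Z_f>0$. For one passive tangent wall channel with fluid impedance $Z_f$, wall impedance $Z_\Gamma>0$ and fluctuation–dissipation noise amplitude $B_\Gamma^2=2\vartheta Z_\Gamma$, the attainable wall displacement covariance $$A_\Gamma^{\rm pass}(Z_\Gamma)=\frac{2\vartheta Z_\Gamma}{(Z_f+Z_\Gamma)^2}$$ satisfies $$A_\Gamma^{\rm pass}(Z_\Gamma)\le\frac{\vartheta}{2Z_f}.$$ Positive target covariances below this maximum are attained at exactly two positive values of $Z_\Gamma$, the maximum is attained at exactly one, and larger targets are attained at none.
   Context: The zero-frequency response amplitude of the scalar passive wall is $(Z_f+Z_\Gamma)^{-1}$, so the displacement covariance is $B_\Gamma^2/(Z_f+Z_\Gamma)^2$. A target value $A^\star$ is attained at $Z_\Gamma$ if $A_\Gamma^{\rm pass}(Z_\Gamma)=A^\star$. *)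

(* Defs.v *)
From mathcomp Require Import all_boot all_order all_algebra.
From mathcomp Require Import boolp classical_sets cardinality reals.

Set Implicit Arguments.
Unset Strict Implicit.
Unset Printing Implicit Defensive.

Import Order.TTheory GRing.Theory Num.Theory.
Local Open Scope classical_set_scope.
Local Open Scope ring_scope.

Section PassiveWall.
Variable R : realType.
Implicit Types (theta Zf Z B A : R).

Definition response_amplitude Zf Z : R := (Zf + Z)^-1.

(* [B] is the noise amplitude itself, so that [B ^+ 2] is B_Gamma^2. *)
Definition displacement_covariance B Zf Z : R :=
  B ^+ 2 * response_amplitude Zf Z ^+ 2.

Definition fluctuation_dissipation theta B Z : Prop :=
  B ^+ 2 = 2 * theta * Z.

Definition A_pass theta Zf Z : R := (2 * theta * Z) / (Zf + Z) ^+ 2.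

Definition attained_at theta Zf A Z : Prop := A_pass theta Zf Z = A.

Definition attaining_impedances theta Zf A : set R :=
  [set Z | 0 < Z /\ attained_at theta Zf A Z].

End PassiveWall.

(* Main.v *)
(** The covariance falls short of [theta / (2 Zf)] by a nonnegative multiple of
    [(Z - Zf)^2], which gives the bound and the unique maximizer [Z = Zf]. Below
    the maximum, [A_pass = A] is the quadratic equation
    [A Z^2 - 2 (theta - A Zf) Z + A Zf^2 = 0], whose reduced discriminant
    [theta (theta - 2 A Zf)] is positive and smaller than [(theta - A Zf)^2]; its
    two roots are therefore real, distinct and positive. *)

Require Import Defs.
From mathcomp Require Import all_boot all_order all_algebra.
From mathcomp Require Import boolp classical_sets cardinality reals.
From mathcomp Require Import ring lra.

Set Implicit Arguments.
Unset Strict Implicit.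
Unset Printing Implicit Defensive.

Import Order.TTheory GRing.Theory Num.Theory.
Local Open Scope classical_set_scope.
Local Open Scope card_scope.
Local Open Scope ring_scope.

Lemma card_set2_II (T : Type) (x y : T) : x <> y -> [set x; y] #= `I_2.
Proof.
move=> xy; apply/eq_cardSP; exists x; first by left.
rewrite (_ : _ `\ x = [set y]); first exact: card_set1.
by apply/seteqP; split=> z /=; [case=> -[] | move=> ->; split; [right | exact: nesym]].
Qed.

Section PassiveWallCovariance.
Variables (R : realType) (theta Zf : R).
Hypotheses (theta_gt0 : 0 < theta) (Zf_gt0 : 0 < Zf).

(** Over the common denominator [2 * Zf * (Zf + Z) ^+ 2] the numerator is [theta] times
    [(Zf + Z) ^+ 2 - 4 * Zf * Z], a perfect square. One identity thus serves both the bound and its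
    equality case. *)
Lemma A_pass_deficit (Z : R) : 0 < Z ->
  theta / (2 * Zf) - A_pass theta Zf Z =
  theta / (2 * Zf) * ((Z - Zf) / (Zf + Z)) ^+ 2.
Proof.
move=> Z0; rewrite /A_pass; field.
by rewrite !gt_eqF // addr_gt0.
Qed.

Lemma A_pass_le_max (Z : R) : 0 < Z -> A_pass theta Zf Z <= theta / (2 * Zf).
Proof.
move=> Z0; rewrite -subr_ge0 A_pass_deficit //.
by rewrite mulr_ge0 ?sqr_ge0 // divr_ge0 ?mulr_ge0 // ltW.
Qed.

Lemma A_pass_eq_max (Z : R) : 0 < Z ->
  (A_pass theta Zf Z == theta / (2 * Zf)) = (Z == Zf).
Proof.
move=> Z0; rewrite eq_sym -subr_eq0 A_pass_deficit //.
rewrite mulf_eq0 (@gt_eqF _ _ (theta / _)) ?divr_gt0 ?mulr_gt0 //=.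
rewrite sqrf_eq0 mulf_eq0 invr_eq0 (@gt_eqF _ _ (Zf + Z)) ?addr_gt0 // orbF.
by rewrite subr_eq0.
Qed.

Lemma A_pass_eqE (A Z : R) : 0 < Z ->
  (A_pass theta Zf Z == A) = (A * (Zf + Z) ^+ 2 == 2 * theta * Z).
Proof.
move=> Z0; have d0 : (Zf + Z) ^+ 2 != 0.
  by rewrite gt_eqF // exprn_gt0 // addr_gt0.
by rewrite /A_pass (can2_eq (divfK d0) (mulfK d0)) eq_sym.
Qed.

Lemma attaining_impedances_below_max (A : R) :
    0 < A -> A < theta / (2 * Zf) ->
  let s := Num.sqrt (theta * (theta - 2 * A * Zf)) in
  [/\ 0 < s, s < theta - A * Zf &
    attaining_impedances theta Zf A =
    [set (theta - A * Zf - s) / A; (theta - A * Zf + s) / A]].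
Proof.
move=> A0; rewrite ltr_pdivlMr ?mulr_gt0 // => AM s.
have D0 : 0 < theta * (theta - 2 * A * Zf) by rewrite mulr_gt0 //; lra.
have AZ0 : 0 < A * Zf by exact: mulr_gt0.
have s0 : 0 < s by rewrite sqrtr_gt0.
have s2 : s ^+ 2 = theta * (theta - 2 * A * Zf) by rewrite sqr_sqrtr // ltW.
have st : s < theta - A * Zf.
  (* Both sides are nonnegative, so their squares may be compared instead. *)
  rewrite -(@ltr_pXn2r _ 2) ?nnegrE ?(ltW s0) //; last by lra.
  rewrite s2 -subr_gt0 (_ : _ - _ = (A * Zf) ^+ 2); last by ring.
  by rewrite exprn_gt0.
(* The extra factor [A] completes the square in [A * Z] and keeps the factors free of division. The
   two sides differ by [s ^+ 2] minus the reduced discriminant, which is zero by [s2]. *)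
have rootE (Z : R) : A * (A * (Zf + Z) ^+ 2 - 2 * theta * Z) =
    (A * Z - (theta - A * Zf - s)) * (A * Z - (theta - A * Zf + s)).
  apply/eqP; rewrite -subr_eq0; apply/eqP.
  transitivity (s ^+ 2 - theta * (theta - 2 * A * Zf)); first by ring.
  by rewrite s2 subrr.
have attE (Z : R) : 0 < Z -> (A_pass theta Zf Z == A) =
    (Z == (theta - A * Zf - s) / A) || (Z == (theta - A * Zf + s) / A).
  move=> Z0; have An0 : A != 0 by rewrite gt_eqF.
  rewrite A_pass_eqE // -subr_eq0 -(inj_eq (mulfI An0)) mulr0 rootE mulf_eq0.
  by rewrite !subr_eq0 ![A * Z]mulrC -!(can2_eq (mulfK An0) (divfK An0)).
split=> //; apply/seteqP; split=> Z /=.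
  by case=> Z0 /eqP; rewrite attE // => /orP[] /eqP ->; [left|right].
(* [attE] presupposes a positive [Z], so positivity of the roots comes first: [st] gives it for the
   smaller root, and [s0] then for the larger. *)
move=> ZE; have Z0 : 0 < Z.
  by case: ZE => ->; rewrite divr_gt0 //; lra.
split=> //; apply/eqP; rewrite attE //.
by case: ZE => ->; rewrite eqxx ?orbT.
Qed.

End PassiveWallCovariance.

Theorem mainTheorem13 (R : realType) (theta Zf : R)
    (theta_gt0 : 0 < theta) (Zf_gt0 : 0 < Zf) :
  (forall B Z : R, 0 < Z -> fluctuation_dissipation theta B Z ->
     displacement_covariance B Zf Z = A_pass theta Zf Z) /\
  (forall Z : R, 0 < Z -> A_pass theta Zf Z <= theta / (2 * Zf)) /\
  (forall A : R, 0 < A -> A < theta / (2 * Zf) ->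
     attaining_impedances theta Zf A #= `I_2) /\
  attaining_impedances theta Zf (theta / (2 * Zf)) #= `I_1 /\
  (forall A : R, theta / (2 * Zf) < A ->
     attaining_impedances theta Zf A = set0).
Proof.
split=> [B Z _ BE|].
  by rewrite /displacement_covariance /response_amplitude BE exprVn.
split=> [Z|]; first exact: A_pass_le_max.
split=> [A A0 AM|].
  have [s0 _ ->] := attaining_impedances_below_max theta_gt0 Zf_gt0 A0 AM.
  (* The numerators of the two roots differ by twice [s], so [s0] orders the roots strictly. *)
  apply/card_set2_II/eqP; rewrite lt_eqF // ltr_pM2r ?invr_gt0 //; lra.
split=> [|A MA].
  rewrite (_ : attaining_impedances _ _ _ = [set Zf]).
    exact: card_set1.
  apply/seteqP; split=> Z /=.
    by case=> Z0 /eqP; rewrite A_pass_eq_max // => /eqP.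
  by move=> ->; split=> //; apply/eqP; rewrite A_pass_eq_max.
apply/seteqP; split=> // Z [Z0 ZA].
by have := le_lt_trans (A_pass_le_max theta_gt0 Zf_gt0 Z0) MA; rewrite ZA ltxx.
Qed.
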